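(* For each integer $d\geq 0$, there is a triangle-free graph $G$ with feedback vertex number equal to $1$ that is not $2$-colourable with defect $d$.
   Context: Graphs are finite, simple and undirected. The feedback vertex number of a graph $G$ is the minimum size of a set $A\subseteq V(G)$ such that $G-A$ is a forest. A $2$-colouring assigns one of at most two colours to each vertex (not necessarily properly). A monochromatic component is a connected component of the subgraph induced by all vertices of a single colour. A colouring has defect $d$ if every monochromatic component has maximum degree at most $d$; $G$ is $2$-colourable with defect $d$ if it has a $2$-colouring with defect $d$. *)

(* Defs.v *)
From mathcomp Require Import all_boot.

Set Implicit Arguments.
Unset Strict Implicit.
Unset Printing Implicit Defensive.

Record sgraph := SGraph {
  vertex :> finType;
  adj : rel vertex;
  adj_sym : symmetric adj;
  adj_irrefl : irreflexive adj }.

Section Induced.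
Variables (G : sgraph) (A : {set G}).

Definition induced_adj : rel {x : G | x \in A} :=
  [rel x y | adj (val x) (val y)].

Lemma induced_adj_sym : symmetric induced_adj.
Proof. by move=> x y; apply: adj_sym. Qed.

Lemma induced_adj_irrefl : irreflexive induced_adj.
Proof. by move=> x; apply: adj_irrefl. Qed.

Definition induced : sgraph := SGraph induced_adj_sym induced_adj_irrefl.

End Induced.

Definition triangle_free (G : sgraph) : Prop :=
  forall x y z : G, ~ [/\ adj x y, adj y z & adj x z].

(* [ucycle] also accepts sequences of length 0 and 2 (an edge traversed back
   and forth), which are not graph cycles; hence the bound on the size. *)
Definition is_forest (G : sgraph) : Prop :=
  forall c : seq G, ~ (2 < size c /\ ucycle (@adj G) c).

Definition feedback_vertex_set (G : sgraph) (A : {set G}) : Prop :=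
  is_forest (induced (~: A)).

Definition has_feedback_vertex_number (G : sgraph) (k : nat) : Prop :=
  (exists2 A : {set G}, feedback_vertex_set A & #|A| = k) /\
  (forall A : {set G}, feedback_vertex_set A -> k <= #|A|).

Definition max_degree (G : sgraph) : nat :=
  \max_(x : G) #|[set y : G | adj x y]|.

Definition components (G : sgraph) : {set {set G}} :=
  [set [set y : G | connect (@adj G) x y] | x : G].

Definition colour_class (G : sgraph) (k : nat) (f : {ffun G -> 'I_k})
    (i : 'I_k) : sgraph :=
  induced [set v : G | f v == i].

Definition has_defect (G : sgraph) (k : nat) (f : {ffun G -> 'I_k})
    (d : nat) : Prop :=
  forall (i : 'I_k) (C : {set colour_class f i}),
    C \in components (colour_class f i) -> max_degree (induced C) <= d.

(* A colouring uses at most [k] colours and need not be proper. *)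
Definition colourable_with_defect (G : sgraph) (k d : nat) : Prop :=
  exists f : {ffun G -> 'I_k}, has_defect f d.

(* Main.v *)
(** Take an apex [r] and [d + 1] disjoint copies of a tree: a star with centre
    [None] and [d + 1] rays whose vertices (the hubs) each carry [d + 1]
    pendant leaves; join [r] to all leaves. If a 2-colouring had defect [d],
    then [r] would have at most [d] leaves of its own colour, so in some copy
    all leaves would have the other colour; a hub of that copy sees [d + 1] of
    these leaves, so it has the colour of [r]. But then the centre of the star
    has [d + 1] neighbours of its own colour. *)

Require Import Defs.
From mathcomp Require Import all_boot.

Set Implicit Arguments.
Unset Strict Implicit.
Unset Printing Implicit Defensive.

Section SimpleGraphs.
Variable G : sgraph.

(** All neighbours of [v] in its own colour lie in the monochromatic component of [v], so they count
    towards a degree there. *)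
Lemma defect_monochromatic_degree k (f : {ffun G -> 'I_k}) d v :
  has_defect f d -> #|[set w | adj v w & f w == f v]| <= d.
Proof.
move=> fd; set H := colour_class f (f v).
have vP : v \in [set w | f w == f v] by rewrite inE.
pose vH : H := exist _ v vP.
pose C := [set y | connect (@adj H) vH y].
have vC : vH \in C by rewrite inE connect0.
pose vHC : induced C := exist _ vH vC.
have CP : C \in components H by apply/imsetP; exists vH.
apply: leq_trans (fd _ _ CP).
apply: leq_trans (leq_bigmax vHC).
apply: leq_trans (leq_imset_card (fun w => val (val w)) _).
apply/subset_leq_card/subsetP=> w; rewrite inE => /andP[vw fw].
have wP : w \in [set w | f w == f v] by rewrite inE.
pose wH : H := exist _ w wP.
have wC : wH \in C by rewrite inE connect1.
by apply/imsetP; exists (exist _ wH wC : induced C); rewrite ?inE.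
Qed.

Lemma defect_monochromatic_star k (f : {ffun G -> 'I_k}) d v
    (g : 'I_d.+1 -> G) :
    has_defect f d -> injective g ->
  ~ (forall i, adj v (g i) /\ f (g i) = f v).
Proof.
move=> fd gI gP; have := defect_monochromatic_degree v fd.
apply/negP; rewrite -ltnNge -[X in X <= _]card_ord -cardsT -(card_imset _ gI).
apply/subset_leq_card/subsetP=> _ /imsetP[i _ ->].
by rewrite inE; case: (gP i) => -> ->; rewrite eqxx.
Qed.

(* A vertex of maximal height on a cycle would have two distinct neighbours
   that are not higher than itself. *)
Lemma forest_height (h : G -> nat) :
  (forall x y z : G,
     adj x y -> adj x z -> h y <= h x -> h z <= h x -> y = z) ->
  is_forest G.
Proof.
move=> hP c [c_gt2 /andP[cc cu]].
have [x0 x0c] : exists x0, x0 \in c.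
  by case: c c_gt2 {cc cu} => // x0 c _; exists x0; rewrite mem_head.
case: (@arg_maxnP _ x0 (mem c) h x0c) => x xc xmax.
case: (rot_to xc) => i [|y s] ec.
  by move: c_gt2; rewrite -(size_rot i) ec.
have memc z : z \in x :: y :: s -> h z <= h x.
  by rewrite -ec mem_rot; apply: xmax.
move: cc cu c_gt2; rewrite -(rot_cycle i) -(rot_uniq i) -(size_rot i) ec.
(* With [x] rotated to the front, its neighbours on the cycle are the second entry [y] and the last
   entry [z]; length above 2 keeps them apart. *)
case/lastP: s => [//|s z] in ec memc *.
rewrite /= !rcons_path last_rcons => /and3P[xy _ zx] /and3P[_ + _] _.
suff -> : y = z by rewrite mem_rcons mem_head.
by apply: hP xy _ _ _; rewrite 1?adj_sym // memc // !inE ?mem_rcons ?mem_head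
  ?eqxx ?orbT.
Qed.

(** A cycle avoiding [A] would lift to a cycle of the forest left after deleting [A]. *)
Lemma feedback_vertex_set_cycle (A : {set G}) (c : seq G) :
    feedback_vertex_set A -> 2 < size c -> ucycle (@adj G) c ->
  exists2 x, x \in c & x \in A.
Proof.
move=> FA c_gt2 cP; apply/hasP; apply: contraT; rewrite -all_predC => cA.
pose c' : seq (induced (~: A)) := pmap insub c.
have ec : c = map val c'.
  rewrite pmap_filter; last exact: insubK.
  apply/esym/all_filterP; apply: sub_all cA => x xA.
  by rewrite isSome_insub inE.
case: (FA c'); split; first by rewrite -(size_map val) -ec.
by move: cP; rewrite /ucycle ec cycle_map map_inj_uniq //; apply: val_inj.
Qed.

End SimpleGraphs.

Section Construction.
Variable d : nat.
Let I := 'I_d.+1.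

(* [None] is the apex, [Some (k, h, None)] is the hub [h] of the copy [k]
   (with [h = None] the centre of the star) and [Some (k, h, Some j)] is the
   [j]-th leaf of this hub. *)
Let V := option (I * option I * option I).

Definition apex_arc (x y : V) : bool :=
  match x, y with
  | None, Some (_, _, Some _) => true
  | Some (k, h, None), Some (k', h', Some _) => (k == k') && (h == h')
  | Some (k, None, None), Some (k', Some _, None) => k == k'
  | _, _ => false
  end.

Definition apex_adj : rel V := [rel x y | apex_arc x y || apex_arc y x].

Lemma apex_adj_sym : symmetric apex_adj.
Proof. by move=> x y; exact: orbC. Qed.

Lemma apex_adj_irrefl : irreflexive apex_adj.
Proof. by case=> [[[k [h|]] [j|]]|]. Qed.

Definition apex_graph : sgraph := SGraph apex_adj_sym apex_adj_irrefl.

(** Only the kinds leaf, centre and outer hub are pairwise joined, and a leaf hangs on just one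
    hub. *)
Lemma apex_graph_triangle_free : triangle_free apex_graph.
Proof.
case=> [[[k1 [h1|]] [j1|]]|] [[[k2 [h2|]] [j2|]]|] [[[k3 [h3|]] [j3|]]|];
  by case; rewrite //= /apex_adj /= ?orbF ?andbF.
Qed.

(** Away from the apex, a leaf has only its hub as a neighbour that is not higher, an outer hub only
    the centre, and the centre none. *)
Definition apex_height (x : V) : nat :=
  match x with
  | Some (_, _, Some _) => 2
  | Some (_, Some _, None) => 1
  | _ => 0
  end.

Lemma apex_feedback_vertex_set :
  feedback_vertex_set ([set None] : {set apex_graph}).
Proof.
have heightP (x y z : V) : x != None -> y != None -> z != None ->
    apex_adj x y -> apex_adj x z ->
    apex_height y <= apex_height x -> apex_height z <= apex_height x -> y = z.
  rewrite /apex_adj /=; move: x y z.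
  case=> [[[k1 [h1|]] [j1|]]|] [[[k2 [h2|]] [j2|]]|] [[[k3 [h3|]] [j3|]]|] //=;
    move=> _ _ _; rewrite ?orbF //;
    (move=> /andP[/eqP ? /eqP ?] /andP[/eqP ? /eqP ?] || move=> /eqP ? /eqP ?);
    congruence.
pose H := induced (~: ([set None] : {set apex_graph})).
have AP (x : H) : val x != None.
  by have := valP x; rewrite !inE.
apply: (@forest_height H (fun x => apex_height (val x))) => x y z xy xz yx zx.
by apply: val_inj; apply: heightP xy xz yx zx; apply: AP.
Qed.

Lemma apex_feedback_vertex_set_gt0 (A : {set apex_graph}) :
  feedback_vertex_set A -> 0 < #|A|.
Proof.
pose o : I := ord0.
(* A 5-cycle: apex, leaf of the centre, centre, outer hub, leaf of that hub. *)
pose c : seq apex_graph :=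
  [:: None; Some (o, None, Some o); Some (o, None, None);
      Some (o, Some o, None); Some (o, Some o, Some o)].
have cP : ucycle (@adj apex_graph) c by [].
move=> FA; have [x _ xA] := feedback_vertex_set_cycle FA (isT : 2 < size c) cP.
by apply/card_gt0P; exists x.
Qed.

Lemma ord2_neq_eq (a b c : 'I_2) : a != b -> c != b -> a = c.
Proof.
by case: a b c => [[|[|a]] ?] [[|[|b]] ?] [[|[|c]] ?] //= *; apply: val_inj.
Qed.

Lemma apex_graph_not_colourable : ~ colourable_with_defect apex_graph 2 d.
Proof.
case=> f fd; pose r : apex_graph := None.
pose leaf k h j : apex_graph := Some (k, h, Some j).
pose hub k h : apex_graph := Some (k, h, None).
have [k kP] : exists k, forall h j, f (leaf k h j) != f r.
  have [/existsP[k /forallP kP]|] :=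
    boolP [exists k, forall p, f (leaf k p.1 p.2) != f r].
    by exists k => h j; apply: (kP (h, j)).
  rewrite negb_exists => /forallP nk.
  (* Otherwise one leaf chosen from each copy gives [r] a monochromatic star with [d.+1] rays. *)
  have {nk} /fin_all_exists[p pP] k : exists p, f (leaf k p.1 p.2) = f r.
    by have := nk k; rewrite negb_forall => /existsP[p /negPn/eqP]; exists p.
  pose g k := leaf k (p k).1 (p k).2.
  case: (@defect_monochromatic_star _ _ _ _ r g fd).
    by move=> k k' [].
  by move=> k; split; last exact: pP.
have hubP h : f (hub k h) = f r.
  apply/eqP; apply: contraT => hr.
  case: (@defect_monochromatic_star _ _ _ _ (hub k h) (leaf k h) fd).
    by move=> j j' [].
  move=> j; split; last exact: ord2_neq_eq (kP h j) hr.
  by rewrite /= /apex_adj /=; case: (h) => *; rewrite !eqxx.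
(* [hubP] covers the centre too, so it shares the colour of [r] with all its rays. *)
pose ray h := hub k (Some h).
case: (@defect_monochromatic_star _ _ _ _ (hub k None) ray fd).
  by move=> h h' [].
by move=> h; rewrite !hubP /= /apex_adj /= eqxx.
Qed.

End Construction.

Theorem proposition15 (d : nat) :
  exists G : sgraph,
    [/\ triangle_free G,
        has_feedback_vertex_number G 1 &
        ~ colourable_with_defect G 2 d].
Proof.
exists (apex_graph d); split.
- exact: apex_graph_triangle_free.
- split; last exact: apex_feedback_vertex_set_gt0.
  by exists [set None]; [exact: apex_feedback_vertex_set | rewrite cards1].
- exact: apex_graph_not_colourable.
Qed.
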